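(* Let $n>1$ and $p\ge 1$, let each $f_i:\mathbb{R}^p\to\mathbb{R}$ ($i=1,\dots,n$) be $\mu_i$-strongly convex ($\mu_i>0$) with $L_i$-Lipschitz continuous gradient, and let $L=\max_i L_i$, $\mu_{\bar f}=\frac1n\sum_{i=1}^n\mu_i$, $L_{\bar f}=\frac1n\sum_{i=1}^n L_i$. Let the steplength satisfy $0<\alpha\le\min\{\frac1L,c_6\}$ with $c_6=\frac{2}{\mu_{\bar f}+L_{\bar f}}$. Then the iterates generated by the NEAR-DGD$^t$+Q method described in the context (with a fixed number $t\ge 1$ of quantized consensus steps per iteration and quantization error bound $\tilde\Delta$) satisfy, for all $k=0,1,2,\dots$, $$\|\bar x_k-x^\star\|\le c_1^k\|\bar x_0-x^\star\|+\frac{c_3\beta^t}{1-c_1}+\frac{c_4\beta^t t\tilde\Delta}{1-c_1}+\frac{c_5t\tilde\Delta}{1-c_1},$$ where $$c_1=\sqrt{1-\alpha c_2},\quad c_2=\frac{2\mu_{\bar f}L_{\bar f}}{\mu_{\bar f}+L_{\bar f}},\quad c_3=\alpha DL,\quad c_4=\frac{2\alpha L}{\nu},\quad c_5=\frac{1}{\sqrt n}\big(\alpha L(\sqrt n+1)+1\big),$$ and $\beta$, $\nu$, $D$, $x^\star$ are as defined in the context.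
   Context: Norms are Euclidean (spectral for matrices). Vectors in $\mathbb{R}^{np}$ are concatenations $\mathbf{x}=[x_1;\dots;x_n]$ of blocks $x_i\in\mathbb{R}^p$, and $\nabla\mathbf{f}(\mathbf{x})=[\nabla f_1(x_1);\dots;\nabla f_n(x_n)]$. Consensus matrix: $\mathbf{W}\in\mathbb{R}^{n\times n}$ is symmetric and doubly stochastic, with $w_{ii}>0$ and, for $i\ne j$, $w_{ij}>0$ if and only if $i,j$ are neighbors in a given connected undirected graph on $\{1,\dots,n\}$ (and $w_{ij}=0$ otherwise). $\mathbf{Z}=\mathbf{W}\otimes I_p$. $\beta$ is the second largest eigenvalue of $\mathbf{W}$ in absolute value, i.e. $\beta=\|\mathbf{W}-\frac1n 1_n1_n^T\|$. NEAR-DGD$^t$+Q method: start from $\mathbf{y}_0\in\mathbb{R}^{np}$. For $k=0,1,2,\dots$, perform $t$ quantized consensus steps from $\mathbf{x}_k^0:=\mathbf{y}_k$: for $j=1,\dots,t$, $\mathbf{x}_k^j=\mathbf{Z}\,\mathcal{Q}[\mathbf{x}_k^{j-1}]$, where $\mathcal{Q}[\mathbf{x}_k^{j-1}]=\mathbf{x}_k^{j-1}+\boldsymbol{\epsilon}_k^{j-1}$; then take a gradient step $\mathbf{y}_{k+1}=\mathbf{x}_k^t-\alpha\nabla\mathbf{f}(\mathbf{x}_k^t)$. The quantization errors $\boldsymbol{\epsilon}_k^{j}=[\epsilon_{1,k}^j;\dots;\epsilon_{n,k}^j]\in\mathbb{R}^{np}$ are only assumed to satisfy, with $\Delta$ the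 distance between consecutive quantization levels, $\|\boldsymbol{\epsilon}_k^j\|\le\sqrt{np}\,\Delta=\tilde\Delta$ and $\|\frac1n\sum_{i}\epsilon_{i,k}^j\|\le\sqrt p\,\Delta=\tilde\Delta/\sqrt n$ for all $k$ and $0\le j\le t-1$. $\bar x_k=\frac1n\sum_{i=1}^n x_{i,k}^t$, where $x_{i,k}^t\in\mathbb{R}^p$ is the $i$-th block of $\mathbf{x}_k^t$. $x^\star=\arg\min_{x\in\mathbb{R}^p}\sum_{i=1}^n f_i(x)$. $\nu=2\alpha\min_i\frac{\mu_iL_i}{\mu_i+L_i}$; $\mathbf{u}^\star=[u_1^\star;\dots;u_n^\star]$ with $u_i^\star=\arg\min_{u}f_i(u)$; $D=\|\mathbf{y}_0-\mathbf{u}^\star\|+\frac{\nu+4}{\nu}\|\mathbf{u}^\star\|$. *)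

(* Defs.v *)
From mathcomp Require Export all_boot all_order all_algebra.
From mathcomp Require Export mxtens.
From mathcomp Require Export all_classical all_reals all_analysis.
Export Order.TTheory GRing.Theory Num.Theory numFieldNormedType.Exports.

Set Implicit Arguments.
Unset Strict Implicit.
Unset Printing Implicit Defensive.

Local Open Scope classical_set_scope.
Local Open Scope ring_scope.

(* The library norm `|x| on matrices is the sup norm, hence the Euclidean and
   spectral norms below.  Both norms induce the same topology, so that
   [differentiable] and ['D_v f x] have their usual meaning on 'cV[R]_p. *)
Definition enorm (R : realType) (m : nat) (x : 'cV[R]_m) : R :=
  Num.sqrt (\sum_(i < m) x i 0 ^+ 2).

Definition spectral_norm (R : realType) (m n : nat) (A : 'M[R]_(m, n)) : R :=
  sup [set enorm (A *m x) | x in [set x : 'cV[R]_n | enorm x <= 1]].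

Definition gradient (R : realType) (p : nat) (f : 'cV[R]_p -> R)
    (x : 'cV[R]_p) : 'cV[R]_p :=
  \col_(i < p) 'D_(delta_mx i 0) f x.

Definition strongly_convex (R : realType) (p : nat) (mu : R)
    (f : 'cV[R]_p -> R) : Prop :=
  forall (x y : 'cV[R]_p) (s : R), 0 <= s <= 1 ->
    f (s *: x + (1 - s) *: y) <=
      s * f x + (1 - s) * f y - mu / 2 * s * (1 - s) * enorm (x - y) ^+ 2.

Definition lipschitz_gradient (R : realType) (p : nat) (L : R)
    (f : 'cV[R]_p -> R) : Prop :=
  (forall x : 'cV[R]_p, differentiable f x) /\
  (forall x y : 'cV[R]_p,
     enorm (gradient f x - gradient f y) <= L * enorm (x - y)).

Definition is_argmin (R : realType) (T : Type) (f : T -> R) (x : T) : Prop :=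
  forall y : T, f x <= f y.

(* For n > 0, the maximum and the minimum of finitely many reals. *)
Definition max_idx (R : realType) (n : nat) (a : 'I_n -> R) : R :=
  sup (range a).
Definition min_idx (R : realType) (n : nat) (a : 'I_n -> R) : R :=
  inf (range a).

(* A vector of R^(np) is a column of length n * p; [mxtens_index (i, j)] is the
   position i * p + j of coordinate j of block i, which is the indexing used by
   the Kronecker product [*t]. *)
Definition block (R : realType) (n p : nat) (x : 'cV[R]_(n * p)) (i : 'I_n) :
    'cV[R]_p :=
  \col_(j < p) x (mxtens_index (i, j)) 0.

Definition stack (R : realType) (n p : nat) (u : 'I_n -> 'cV[R]_p) :
    'cV[R]_(n * p) :=
  \col_(k < n * p) u (mxtens_unindex k).1 (mxtens_unindex k).2 0.

Definition block_mean (R : realType) (n p : nat) (x : 'cV[R]_(n * p)) :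
    'cV[R]_p :=
  n%:R^-1 *: \sum_(i < n) block x i.

Definition stacked_gradient (R : realType) (n p : nat)
    (f : 'I_n -> 'cV[R]_p -> R) (x : 'cV[R]_(n * p)) : 'cV[R]_(n * p) :=
  stack (fun i => gradient (f i) (block x i)).

Record connected_graph (n : nat) (e : rel 'I_n) : Prop := {
  graph_sym : symmetric e;
  graph_irrefl : irreflexive e;
  graph_connected : forall i j : 'I_n, connect e i j }.

Record doubly_stochastic (R : realType) (n : nat) (W : 'M[R]_n) : Prop := {
  ds_ge0 : forall i j : 'I_n, 0 <= W i j;
  ds_row : forall i : 'I_n, \sum_(j < n) W i j = 1;
  ds_col : forall j : 'I_n, \sum_(i < n) W i j = 1 }.

Record consensus_matrix (R : realType) (n : nat) (e : rel 'I_n)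
    (W : 'M[R]_n) : Prop := {
  cm_sym : W^T = W;
  cm_ds : doubly_stochastic W;
  cm_diag : forall i : 'I_n, 0 < W i i;
  cm_edge : forall i j : 'I_n, i != j -> (0 < W i j <-> e i j);
  cm_nonedge : forall i j : 'I_n, i != j -> ~~ e i j -> W i j = 0 }.

(* beta = || W - (1/n) 1 1^T ||, which for a consensus matrix W is its second
   largest eigenvalue in absolute value. *)
Definition consensus_rate (R : realType) (n : nat) (W : 'M[R]_n) : R :=
  spectral_norm
    (W - n%:R^-1 *: ((const_mx 1 : 'cV[R]_n) *m (const_mx 1 : 'cV[R]_n)^T)).

(* [x k j] is the vector after j of the t quantized consensus steps of
   iteration k, and [eps k j] the error made in quantizing it. *)
Record near_dgd_q (R : realType) (n p : nat) (f : 'I_n -> 'cV[R]_p -> R)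
    (W : 'M[R]_n) (alpha : R) (t : nat) (y : nat -> 'cV[R]_(n * p))
    (x eps : nat -> nat -> 'cV[R]_(n * p)) : Prop := {
  dgd_init : forall k : nat, x k 0%N = y k;
  dgd_consensus : forall k j : nat, (j < t)%N ->
    x k j.+1 = (W *t (1%:M : 'M[R]_p)) *m (x k j + eps k j);
  dgd_gradient : forall k : nat,
    y k.+1 = x k t - alpha *: stacked_gradient f (x k t) }.

(* [Delta] is the distance between consecutive quantization levels. *)
Definition quantization_error_bound (R : realType) (n p t : nat) (Delta : R)
    (eps : nat -> nat -> 'cV[R]_(n * p)) : Prop :=
  forall k j : nat, (j < t)%N ->
    enorm (eps k j) <= Num.sqrt (n * p)%:R * Delta /\
    enorm (block_mean (eps k j)) <= Num.sqrt p%:R * Delta.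

(* Main.v *)
Require Import Defs.
From mathcomp Require Import ring lra.

Set Implicit Arguments.
Unset Strict Implicit.
Unset Printing Implicit Defensive.

Local Open Scope ring_scope.

(** A gradient step on a [mu]-strongly convex
    function with [L]-Lipschitz gradient contracts the distance to the minimizer
    by [sqrt (1 - 2 alpha mu L / (mu + L))], by cocoercivity of the gradient.
    Applied block by block, this keeps the iterates [y k] within a bounded
    distance of [stack ustar]; since consensus contracts the deviation from the
    block mean by [beta], that deviation is then at most
    [beta ^+ t * (D + 2 t tDelta / nu) + t tDelta] after [t] steps.
    Applied to the average function, it shows that the block mean follows an
    exact gradient step on the average up to [alpha * L] times the deviation and
    [t] mean quantization errors, whence an affine recursion for the error. *)

(** * Euclidean inner product and norm *)

Definition dotv (R : realType) (m : nat) (u v : 'cV[R]_m) : R :=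
  \sum_(i < m) u i 0 * v i 0.

Section Euclidean.
Variables (R : realType) (m : nat).
Implicit Types (u v w : 'cV[R]_m) (a : R).

Lemma dotvC u v : dotv u v = dotv v u.
Proof. by apply: eq_bigr => i _; rewrite mulrC. Qed.

Lemma dotvDl u v w : dotv (u + v) w = dotv u w + dotv v w.
Proof. by rewrite -big_split; apply: eq_bigr => i _; rewrite mxE mulrDl. Qed.

Lemma dotvZl a u v : dotv (a *: u) v = a * dotv u v.
Proof. by rewrite mulr_sumr; apply: eq_bigr => i _; rewrite mxE mulrA. Qed.

Lemma dotvNl u v : dotv (- u) v = - dotv u v.
Proof. by rewrite -scaleN1r dotvZl mulN1r. Qed.

Lemma dotvDr u v w : dotv w (u + v) = dotv w u + dotv w v.
Proof. by rewrite dotvC dotvDl !(dotvC w). Qed.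

Lemma dotvZr a u v : dotv v (a *: u) = a * dotv v u.
Proof. by rewrite dotvC dotvZl (dotvC v). Qed.

Lemma dotvNr u v : dotv v (- u) = - dotv v u.
Proof. by rewrite dotvC dotvNl (dotvC v). Qed.

Definition dotvE := (dotvDl, dotvDr, dotvNl, dotvNr, dotvZl, dotvZr).

Lemma dotv_suml (I : finType) (F : I -> 'cV[R]_m) v :
  dotv (\sum_i F i) v = \sum_i dotv (F i) v.
Proof.
apply: (big_morph (fun u => dotv u v)) => [u w|]; first exact: dotvDl.
by rewrite -(scale0r v) dotvZl mul0r.
Qed.

Lemma enorm_ge0 u : 0 <= enorm u.
Proof. exact: sqrtr_ge0. Qed.

Lemma sqr_enorm u : enorm u ^+ 2 = dotv u u.
Proof.
rewrite sqr_sqrtr; last by apply: sumr_ge0 => i _; exact: sqr_ge0.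
by apply: eq_bigr => i _; rewrite expr2.
Qed.

Lemma enorm_le u a : 0 <= a -> enorm u ^+ 2 <= a ^+ 2 -> enorm u <= a.
Proof. by move=> a0; rewrite ler_sqr ?nnegrE ?enorm_ge0. Qed.

Lemma enorm0 : enorm (0 : 'cV[R]_m) = 0.
Proof.
by rewrite /enorm big1 ?sqrtr0// => i _; rewrite mxE expr0n.
Qed.

Lemma enorm0_eq0 u : enorm u = 0 -> u = 0.
Proof.
move=> u0; have /eqP : dotv u u = 0 by rewrite -sqr_enorm u0 expr0n.
rewrite psumr_eq0; last by move=> i _; rewrite -expr2 sqr_ge0.
move=> /allP H; apply/colP => i; rewrite mxE.
by have := H i (mem_index_enum i); rewrite /= -expr2 sqrf_eq0 => /eqP.
Qed.

(** Cauchy-Schwarz: the squared norm of [enorm v *: u - enorm u *: v] is [2 * enorm u * enorm v]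
    times the difference of the two sides. *)
Lemma dotv_le u v : dotv u v <= enorm u * enorm v.
Proof.
have [u0|u0] := eqVneq (enorm u) 0.
  by rewrite u0 mul0r (enorm0_eq0 u0) -(scale0r (0 : 'cV[R]_m)) dotvZl mul0r.
have [v0|v0] := eqVneq (enorm v) 0.
  by rewrite v0 mulr0 (enorm0_eq0 v0) -(scale0r (0 : 'cV[R]_m)) dotvZr mul0r.
have uv_gt0 : 0 < enorm u * enorm v by rewrite mulr_gt0// lt_def ?u0 ?v0 enorm_ge0.
rewrite -subr_ge0 -(pmulr_rge0 _ uv_gt0).
have := sqr_ge0 (enorm (enorm v *: u - enorm u *: v)).
rewrite sqr_enorm !dotvE -!sqr_enorm (dotvC v u); nra.
Qed.

Lemma normr_dotv_le u v : `|dotv u v| <= enorm u * enorm v.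
Proof.
rewrite ler_norml dotv_le andbT lerNl -dotvNl.
apply: le_trans (dotv_le _ _) _; rewrite ler_wpM2r ?enorm_ge0//.
by rewrite enorm_le ?enorm_ge0// sqr_enorm !dotvE opprK sqr_enorm.
Qed.

Lemma enormD u v : enorm (u + v) <= enorm u + enorm v.
Proof.
apply: enorm_le; first by rewrite addr_ge0 ?enorm_ge0.
rewrite sqr_enorm !dotvE -!sqr_enorm (dotvC v u).
have := dotv_le u v; nra.
Qed.

Lemma enormZ a u : enorm (a *: u) = `|a| * enorm u.
Proof.
apply/eqP; rewrite -(@eqrXn2 _ 2)// ?mulr_ge0 ?enorm_ge0//.
by rewrite exprMn !sqr_enorm !dotvE real_normK ?num_real// mulrA -expr2.
Qed.

Lemma enormN u : enorm (- u) = enorm u.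
Proof. by rewrite -scaleN1r enormZ normrN1 mul1r. Qed.

Lemma enorm_sum (I : finType) (F : I -> 'cV[R]_m) :
  enorm (\sum_i F i) <= \sum_i enorm (F i).
Proof.
elim/big_ind2: _ => [|u a v b ua vb|//]; first by rewrite enorm0.
by apply: le_trans (enormD _ _) _; exact: lerD.
Qed.

End Euclidean.

(* The two inequalities are the only facts about f that the analysis of the
   gradient step needs, and they are stable under averaging. *)
Definition quad_sandwich (R : realType) (p : nat) (mu L : R)
    (f : 'cV[R]_p -> R) (G : 'cV[R]_p -> 'cV[R]_p) : Prop :=
  forall x y : 'cV[R]_p,
    f x + dotv (G x) (y - x) + mu / 2 * enorm (y - x) ^+ 2 <= f y <=
    f x + dotv (G x) (y - x) + L / 2 * enorm (y - x) ^+ 2.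

(** * Directional derivatives and the mean value theorem along a segment *)

Section Gradient.
Variables (R : realType) (p : nat).
Implicit Types (f : 'cV[R]_p -> R) (x y d : 'cV[R]_p).

Lemma derive_gradient f x d :
  differentiable f x -> 'D_d f x = dotv (gradient f x) d.
Proof.
move=> df; rewrite deriveE// {1}(matrix_sum_delta d) raddf_sum.
apply: eq_bigr => i _; rewrite big_ord1 mxE deriveE// mulrC.
exact: (linearZ (R := R) (U := 'cV[R]_p) (V := R^o)).
Qed.

(** The difference quotients of the restriction to the line are those that define ['D_d f] at
    [x + s *: d], so no chain rule is involved. *)
Lemma is_derive_segment f x d (s : R) : differentiable f (x + s *: d) ->
  is_derive s 1 (fun r : R => f (x + r *: d)) ('D_d f (x + s *: d)).
Proof.
move=> df; have dv : derivable f (x + s *: d) d by exact: diff_derivable.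
have E : (fun h : R => h^-1 *: (((fun r : R => f (x + r *: d)) \o shift s) (h *: 1)
    - f (x + s *: d))) =
    (fun h : R => h^-1 *: ((f \o shift (x + s *: d)) (h *: d) - f (x + s *: d))).
  apply/funext => h /=; congr (_ *: (f _ - _)).
  by rewrite scalerDl [h *: 1]mulr1 addrCA.
split; first by rewrite /derivable E.
by rewrite /derive E.
Qed.

(** Mean value theorem for [f] along the segment minus a quadratic in [s]. The free coefficient [K]
    later yields [L / 2] instead of [L]: for [K = L / 2] or [K = - (L / 2)], the term in [K] offsets
    the Lipschitz bound [L * c * enorm d ^+ 2]. *)
Lemma taylor_segment f x d (K : R) : (forall z, differentiable f z) ->
  exists2 c : R, 0 < c < 1 &
    f (x + d) - f x - dotv (gradient f x) d - K * enorm d ^+ 2 =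
    dotv (gradient f (x + c *: d) - gradient f x) d - 2 * K * c * enorm d ^+ 2.
Proof.
move=> df; pose a := dotv (gradient f x) d; pose N := enorm d ^+ 2.
pose phi (s : R) := f (x + s *: d) - (s * a + s ^+ 2 * (K * N)).
have dphi (s : R) : is_derive s 1 phi
    ('D_d f (x + s *: d) - (a + 2 * s * (K * N))).
  have h1 := is_derive_segment (df (x + s *: d)).
  apply: is_deriveB; apply: is_derive_eq.
  rewrite !scaler0 add0r add0r.
  rewrite /GRing.scale/= ; ring.
have [|c] := @MVT R phi _ 0 1 ltr01 (fun s _ => dphi s).
  apply: derivable_within_continuous => s _; exact: ex_derive.
rewrite in_itv/= => c01; rewrite /phi scale0r scale1r addr0 derive_gradient// => E.
exists c => //; move: E; rewrite !dotvE -/a -/N; lra.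
Qed.

End Gradient.

(** * Smooth strongly convex functions and cocoercivity *)

Section SmoothStronglyConvex.
Variables (R : realType) (p : nat).
Implicit Types (f : 'cV[R]_p -> R) (G : 'cV[R]_p -> 'cV[R]_p) (x y d : 'cV[R]_p).

Lemma lipschitz_gradient_taylor f (L : R) x d : lipschitz_gradient L f ->
  `|f (x + d) - f x - dotv (gradient f x) d| <= L / 2 * enorm d ^+ 2.
Proof.
move=> [df lip]; have N0 := enorm_ge0 d.
have bnd (c : R) : 0 < c < 1 ->
    `|dotv (gradient f (x + c *: d) - gradient f x) d| <= L * c * enorm d ^+ 2.
  move=> /andP[c0 _]; apply: le_trans (normr_dotv_le _ _) _.
  rewrite expr2 mulrA ler_wpM2r//.
  have := lip (x + c *: d) x.
  by rewrite addrAC subrr add0r enormZ gtr0_norm// mulrA.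
rewrite ler_norml; apply/andP; split.
  have [c c01] := taylor_segment x d (- (L / 2)) df.
  by have := bnd c c01; rewrite ler_norml => /andP[]; lra.
have [c c01] := taylor_segment x d (L / 2) df.
by have := bnd c c01; rewrite ler_norml => /andP[]; lra.
Qed.

(** The upper bound is the Taylor estimate. For the lower one, strong convexity on the chord is
    compared with the Taylor estimate at [x + s *: d] and divided by [s]; the error is [s * C], and
    [s] tends to 0. *)
Lemma quad_sandwich_gradient f (mu L : R) :
  strongly_convex mu f -> lipschitz_gradient L f ->
  quad_sandwich mu L f (gradient f).
Proof.
move=> scf lipf x y; set d := y - x.
have -> : y = x + d by rewrite addrC subrK.
apply/andP; split; last first.
  have := lipschitz_gradient_taylor x d lipf.
  by rewrite ler_norml => /andP[]; lra.
set N := enorm d ^+ 2; set C := (mu + L) / 2 * N.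
have chord (s : R) : 0 < s <= 1 ->
    f x + dotv (gradient f x) d + mu / 2 * N <= f (x + d) + s * C.
  move=> /andP[s0 s1].
  have := scf (x + d) x s; rewrite (ltW s0) s1 => /(_ isT).
  rewrite (_ : s *: (x + d) + (1 - s) *: x = x + s *: d); last first.
    by apply/colP => i; rewrite !mxE; ring.
  rewrite (_ : x + d - x = d); last by rewrite addrAC subrr add0r.
  have := lipschitz_gradient_taylor x (s *: d) lipf.
  rewrite ler_norml enormZ gtr0_norm// exprMn dotvZr -/N => /andP[h1 _] h2.
  by rewrite -(ler_pM2l s0) /C; nra.
apply/ler_addgt0Pr => e e0; have C0 : 0 < `|C| + 1 by rewrite ltr_pwDr.
(* [|C| + 1] is positive whatever [C] is, so this [s] lies in the allowed range and gives
   [s * C <= e]. *)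
pose s := Num.min 1 (e / (`|C| + 1)).
have s0 : 0 < s by rewrite lt_min ltr01 divr_gt0.
have s1 : s <= 1 by rewrite ge_min lexx.
apply: le_trans (chord s _) _; first by rewrite s0.
rewrite lerD2l; apply: le_trans (_ : s * (`|C| + 1) <= _).
  by rewrite ler_pM2l//; apply: le_trans (ler_norm _) _; rewrite lerDl.
by rewrite -ler_pdivlMr// ge_min lexx orbT.
Qed.

Lemma quad_sandwich_le f G (mu L : R) : (0 < p)%N ->
  quad_sandwich mu L f G -> mu <= L.
Proof.
case: p f G => // q f G _ H; have /andP[h1 h2] := H 0 (const_mx 1).
have := le_trans h1 h2; rewrite subr0 lerD2l ler_pM2r ?ler_pM2r//.
rewrite exprn_gt0// lt_def enorm_ge0 andbT; apply/negP => /eqP /enorm0_eq0.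
by move=> /colP/(_ 0)/eqP; rewrite !mxE oner_eq0.
Qed.

(** The majorant at [x - L^-1 *: G x] lies [enorm (G x) ^+ 2 / (2 * L)] below [f x], which
    minimality forbids unless [G x = 0]. No derivative of [f] enters, so this also serves for an
    average of functions. *)
Lemma quad_sandwich_argmin f G (mu L : R) x : 0 < L ->
  quad_sandwich mu L f G -> is_argmin f x -> G x = 0.
Proof.
move=> L0 H minx; apply: enorm0_eq0; apply/eqP; rewrite -sqrf_eq0.
have /andP[_] := H x (x - L^-1 *: G x); rewrite [x - _ - x]addrC addKr.
move=> /(le_trans (minx _)).
rewrite enormN enormZ exprMn gtr0_norm ?invr_gt0// !dotvE -sqr_enorm.
have -> : L / 2 * (L^-1 ^+ 2 * enorm (G x) ^+ 2) = L^-1 / 2 * enorm (G x) ^+ 2.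
  by field; lra.
move=> h; rewrite eq_le sqr_ge0 andbT.
have iL : 0 < L^-1 by rewrite invr_gt0.
have := sqr_ge0 (enorm (G x)); nra.
Qed.

(* Sandwich f between its quadratic minorant at x and its quadratic majorant at
   y, at the point y - s * (g y - g x) with g = G - mu id, and symmetrically;
   s is then chosen optimally. *)
Lemma cocoercive f G (mu L : R) x y : mu <= L -> quad_sandwich mu L f G ->
  mu * L * enorm (x - y) ^+ 2 + enorm (G x - G y) ^+ 2 <=
  (mu + L) * dotv (G x - G y) (x - y).
Proof.
move=> muL H.
have [d dE] : {d | d = x - y} by exists (x - y).
have [g gE] : {g | g = G x - G y} by exists (G x - G y).
have [w wE] : {w | w = g - mu *: d} by exists (g - mu *: d).
rewrite -dE -gE.
pose A := dotv g d - mu * enorm d ^+ 2.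
have key (s : R) : (2 * s - (L - mu) * s ^+ 2) * enorm w ^+ 2 <= A.
  have /andP[l1 _] := H x (y + s *: w); have /andP[_ u1] := H y (y + s *: w).
  have /andP[l2 _] := H y (x - s *: w); have /andP[_ u2] := H x (x - s *: w).
  have := le_trans l2 u2; have := le_trans l1 u1.
  have -> : y + s *: w - x = s *: w - d by rewrite dE opprB addrAC addrC addrA.
  have -> : y + s *: w - y = s *: w by rewrite addrAC subrr add0r.
  have -> : x - s *: w - y = d - s *: w by rewrite dE addrAC.
  have -> : x - s *: w - x = - (s *: w) by rewrite addrAC subrr add0r.
  have gw : s * (dotv (G x) w - dotv (G y) w) = s * (dotv w w + mu * dotv d w).
    by congr (_ * _); rewrite -dotvZl -dotvDl wE subrK gE dotvDl dotvNl.
  have gd : dotv g d = dotv (G x) d - dotv (G y) d by rewrite gE dotvDl dotvNl.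
  rewrite /A gd !sqr_enorm !dotvE (dotvC w d); lra.
move: key; rewrite /A; have := sqr_ge0 (enorm w).
have -> : enorm w ^+ 2 =
    enorm g ^+ 2 - 2 * mu * dotv g d + mu ^+ 2 * enorm d ^+ 2.
  by rewrite wE !sqr_enorm !dotvE (dotvC d g); ring.
set N : R := (X in 0 <= X) => N0; rewrite -/N => key.
suff : N <= (L - mu) * (dotv g d - mu * enorm d ^+ 2) by rewrite /N; lra.
(* For [mu = L] the coefficient of [s ^+ 2] vanishes, and a positive [N] would make the left side of
   [key] unbounded; the [s] below gives it the value [T + 1]. *)
have [Lmu|Lmu] := eqVneq mu L.
  rewrite Lmu subrr mul0r leNgt; apply/negP => Npos.
  set T := dotv g d - mu * enorm d ^+ 2 in key.
  have := key ((T + 1) / (2 * N)).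
  have -> : (2 * ((T + 1) / (2 * N)) - (L - mu) * ((T + 1) / (2 * N)) ^+ 2) * N
    = T + 1 by rewrite Lmu; field; rewrite gt_eqF.
  by rewrite gerDl ler10.
have L0 : 0 < L - mu by rewrite subr_gt0 lt_neqAle Lmu.
(* [s = (L - mu)^-1] maximizes [2 * s - (L - mu) * s ^+ 2], with maximum [(L - mu)^-1]. *)
rewrite -ler_pdivrMl//; apply: le_trans (key (L - mu)^-1).
rewrite le_eqVlt; apply/orP; left; apply/eqP; field; lra.
Qed.

(** Expanding the square leaves [a ^+ 2 * enorm (G x) ^+ 2], which the gradient term of cocoercivity
    absorbs because [a <= 2 / (mu + L)]; its distance term gives the factor. *)
Lemma gradient_step_contraction f G (mu L a : R) x xs :
  0 < mu -> mu <= L -> 0 <= a -> a <= 2 / (mu + L) ->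
  quad_sandwich mu L f G -> G xs = 0 ->
  enorm (x - a *: G x - xs) ^+ 2 <=
  (1 - a * (2 * mu * L / (mu + L))) * enorm (x - xs) ^+ 2.
Proof.
move=> mu0 muL a0 aL H Gxs; have S0 : 0 < mu + L by lra.
have := cocoercive x xs muL H; rewrite Gxs subr0.
rewrite addrAC; move: (x - xs) => d; rewrite (sqr_enorm (d - _)) !dotvE.
rewrite (dotvC d) -!sqr_enorm.
set P := dotv _ _; set g2 := enorm (G x) ^+ 2; set d2 := enorm d ^+ 2 => hP.
have {}hP : mu * L / (mu + L) * d2 + g2 / (mu + L) <= P.
  by rewrite -(ler_pM2l S0); apply: le_trans hP; rewrite le_eqVlt; apply/orP;
     left; apply/eqP; field; lra.
have g20 : 0 <= g2 by exact: sqr_ge0.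
have h1 := ler_wpM2l a0 hP.
have h2 : a * (a * g2) <= a * (2 / (mu + L) * g2).
  by rewrite ler_wpM2l// ler_wpM2r.
lra.
Qed.

End SmoothStronglyConvex.

(** * The spectral norm as an operator bound *)

Section SpectralNorm.
Variables (R : realType) (m n : nat).
Implicit Types A : 'M[R]_(m, n).

Let frobenius_bound A (x : 'cV[R]_n) :
  enorm (A *m x) ^+ 2 <= (\sum_i enorm (row i A)^T ^+ 2) * enorm x ^+ 2.
Proof.
rewrite sqr_enorm mulr_suml; apply: ler_sum => i _.
have -> : (A *m x) i 0 = dotv (row i A)^T x.
  by rewrite mxE; apply: eq_bigr => j _; rewrite !mxE.
by rewrite -expr2 -exprMn -real_normK ?num_real// ler_sqr ?nnegrE
  ?mulr_ge0 ?enorm_ge0// normr_dotv_le.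
Qed.

(** Makes the supremum in [spectral_norm] a genuine one; the Frobenius norm is a bound, by
    Cauchy-Schwarz in each row. *)
Let has_ubound_spectral A :
  has_ubound [set enorm (A *m x) | x in [set x : 'cV[R]_n | enorm x <= 1]]%classic.
Proof.
pose F := \sum_i enorm (row i A)^T ^+ 2.
exists (Num.sqrt F) => _ [z /= z1 <-]; rewrite /enorm ler_sqrt; last first.
  by apply: sumr_ge0 => i _; exact: sqr_ge0.
have := frobenius_bound A z.
rewrite sqr_sqrtr; last by apply: sumr_ge0 => i _; exact: sqr_ge0.
move=> /le_trans; apply; apply: ler_piMr.
  by apply: sumr_ge0 => i _; exact: sqr_ge0.
by rewrite expr_le1 ?enorm_ge0.
Qed.

Lemma spectral_norm_ge0 A : 0 <= spectral_norm A.
Proof.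
apply: le_trans (enorm_ge0 (A *m 0)) _.
apply: (ub_le_sup (has_ubound_spectral A)).
by exists 0 => //=; rewrite enorm0 ler01.
Qed.

Lemma enorm_mulmx_le A (x : 'cV[R]_n) :
  enorm (A *m x) <= spectral_norm A * enorm x.
Proof.
have [/enorm0_eq0->|x0] := eqVneq (enorm x) 0; first by rewrite mulmx0 !enorm0 mulr0.
have xgt0 : 0 < enorm x by rewrite lt_def x0 enorm_ge0.
rewrite -ler_pdivrMr// mulrC.
have -> : (enorm x)^-1 * enorm (A *m x) = enorm (A *m ((enorm x)^-1 *: x)).
  by rewrite -scalemxAr enormZ gtr0_norm ?invr_gt0.
apply: (ub_le_sup (has_ubound_spectral A)); exists ((enorm x)^-1 *: x) => //=.
by rewrite enormZ gtr0_norm ?invr_gt0// mulVf.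
Qed.

Lemma spectral_norm_le A (b : R) :
  0 <= b -> (forall x : 'cV[R]_n, enorm (A *m x) <= b * enorm x) ->
  spectral_norm A <= b.
Proof.
move=> b0 H; apply: ge_sup.
  by exists (enorm (A *m 0)), 0 => //=; rewrite enorm0 ler01.
move=> _ [z /= z1 <-]; apply: le_trans (H z) _.
by rewrite ler_piMr.
Qed.

End SpectralNorm.

(** * The averaging matrix and doubly stochastic matrices *)

Section Averaging.
Variables (R : realType) (n : nat).
Implicit Types (v : 'cV[R]_n) (W : 'M[R]_n).

(** For [n > 0], the orthogonal projection onto the constant vectors, written as in [consensus_rate]
    so that the two agree by conversion. *)
Definition avg_mx : 'M[R]_n :=
  n%:R^-1 *: ((const_mx 1 : 'cV[R]_n) *m (const_mx 1 : 'cV[R]_n)^T).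

Lemma avg_mxE i j : avg_mx i j = n%:R^-1.
Proof. by rewrite !mxE big_ord1 !mxE !mulr1. Qed.

Lemma avg_mulmxE v i : (avg_mx *m v) i 0 = n%:R^-1 * \sum_j v j 0.
Proof. by rewrite mxE mulr_sumr; apply: eq_bigr => j _; rewrite avg_mxE. Qed.

Lemma mulmx_avg W : doubly_stochastic W -> W *m avg_mx = avg_mx.
Proof.
move=> [_ Wr _]; apply/matrixP => i j; rewrite mxE.
under eq_bigr do rewrite avg_mxE.
by rewrite -mulr_suml Wr mul1r avg_mxE.
Qed.

Lemma avg_mulmx W : doubly_stochastic W -> avg_mx *m W = avg_mx.
Proof.
move=> [_ _ Wc]; apply/matrixP => i j; rewrite mxE.
under eq_bigr do rewrite avg_mxE.
by rewrite -mulr_sumr Wc mulr1 avg_mxE.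
Qed.

Lemma avg_doubly_stochastic : (0 < n)%N -> doubly_stochastic avg_mx.
Proof.
move=> n0; have n0' : n%:R != 0 :> R by rewrite pnatr_eq0 -lt0n.
split=> [i j|i|j]; first by rewrite avg_mxE invr_ge0 ler0n.
- under eq_bigr do rewrite avg_mxE.
  by rewrite sumr_const card_ord -[X in X = _]mulr_natr mulVf.
- under eq_bigr do rewrite avg_mxE.
  by rewrite sumr_const card_ord -[X in X = _]mulr_natr mulVf.
Qed.

(* Jensen's inequality in each row of W, then summation over the columns. *)
Lemma doubly_stochastic_enorm_le W v :
  doubly_stochastic W -> enorm (W *m v) <= enorm v.
Proof.
move=> [W0 Wr Wc]; apply: enorm_le; first exact: enorm_ge0.
have jensen i : (W *m v) i 0 ^+ 2 <= \sum_j W i j * v j 0 ^+ 2.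
  have : 0 <= \sum_j W i j * (v j 0 - (W *m v) i 0) ^+ 2.
    by apply: sumr_ge0 => j _; rewrite mulr_ge0 ?sqr_ge0.
  set s := (W *m v) i 0.
  have -> : \sum_j W i j * (v j 0 - s) ^+ 2 =
      \sum_j (W i j * v j 0 ^+ 2 - 2 * s * (W i j * v j 0) + s ^+ 2 * W i j).
    by apply: eq_bigr => j _; ring.
  rewrite !big_split/= sumrN -!mulr_sumr Wr.
  have -> : \sum_j W i j * v j 0 = s by rewrite /s mxE.
  lra.
rewrite !sqr_enorm /dotv; under eq_bigr do rewrite -expr2.
apply: le_trans (ler_sum _ (fun i _ => jensen i)) _.
rewrite exchange_big/=; apply: ler_sum => j _.
by rewrite -mulr_suml Wc mul1r expr2.
Qed.

(** Pythagoras: by [E], the squared left side is [enorm v ^+ 2 - enorm (avg_mx *m v) ^+ 2]. *)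
Lemma enorm_sub_avg_le v : (0 < n)%N -> enorm (v - avg_mx *m v) <= enorm v.
Proof.
move=> n0; have n0' : n%:R != 0 :> R by rewrite pnatr_eq0 -lt0n.
apply: enorm_le; first exact: enorm_ge0.
have E : dotv (avg_mx *m v) (avg_mx *m v) = dotv v (avg_mx *m v).
  rewrite /dotv; under eq_bigr do rewrite avg_mulmxE.
  under [RHS]eq_bigr do rewrite avg_mulmxE.
  by rewrite sumr_const card_ord -[LHS]mulr_natr -mulr_suml; field.
rewrite sqr_enorm !dotvE (dotvC _ v) -E -!sqr_enorm.
have := sqr_ge0 (enorm (avg_mx *m v)); lra.
Qed.

Lemma consensus_rate_ge0 W : 0 <= consensus_rate W.
Proof. exact: spectral_norm_ge0. Qed.

Lemma consensus_rate_enorm_le W v :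
  enorm ((W - avg_mx) *m v) <= consensus_rate W * enorm v.
Proof. exact: enorm_mulmx_le. Qed.

(** Since [avg_mx *m W = avg_mx], the matrix [W - avg_mx] is [W] followed by removal of the mean,
    and both maps are nonexpansive. *)
Lemma consensus_rate_le1 W :
  (0 < n)%N -> doubly_stochastic W -> consensus_rate W <= 1.
Proof.
move=> n0 dsW; apply: spectral_norm_le => // v; rewrite mul1r -/avg_mx.
have -> : (W - avg_mx) *m v = W *m v - avg_mx *m (W *m v).
  by rewrite mulmxA (avg_mulmx dsW) mulmxBl.
by apply: le_trans (enorm_sub_avg_le _ n0) (doubly_stochastic_enorm_le _ dsW).
Qed.

End Averaging.

(** * Block vectors and Kronecker products with the identity *)

Section Blocks.
Variables (R : realType) (n p : nat).
Implicit Types (x y : 'cV[R]_(n * p)) (W : 'M[R]_n).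

(** Coordinate [j] across all blocks. On each slice [W *t 1%:M] acts as [W] itself, so norm bounds
    for [W] pass to the Kronecker product. *)
Let slice x (j : 'I_p) : 'cV[R]_n := \col_i x (mxtens_index (i, j)) 0.

Lemma sum_mxtens (F : 'I_(n * p) -> R) :
  \sum_k F k = \sum_(i < n) \sum_(j < p) F (mxtens_index (i, j)).
Proof.
rewrite pair_big/= (reindex (@mxtens_index n p))/=.
  by apply: eq_bigr => -[].
by exists (@mxtens_unindex n p) => k _; rewrite (mxtens_indexK, mxtens_unindexK).
Qed.

Lemma sqr_enorm_block x : enorm x ^+ 2 = \sum_i enorm (block x i) ^+ 2.
Proof.
rewrite sqr_enorm /dotv sum_mxtens; apply: eq_bigr => i _.
by rewrite sqr_enorm; apply: eq_bigr => j _; rewrite !mxE.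
Qed.

Let sqr_enorm_slice x : enorm x ^+ 2 = \sum_j enorm (slice x j) ^+ 2.
Proof.
rewrite sqr_enorm /dotv sum_mxtens exchange_big; apply: eq_bigr => j _.
by rewrite sqr_enorm; apply: eq_bigr => i _; rewrite !mxE.
Qed.

Lemma enorm_block_le x i : enorm (block x i) <= enorm x.
Proof.
apply: enorm_le; first exact: enorm_ge0.
rewrite sqr_enorm_block (bigD1 i)//= lerDl; apply: sumr_ge0 => j _.
exact: sqr_ge0.
Qed.

Lemma block_stack (u : 'I_n -> 'cV[R]_p) i : block (stack u) i = u i.
Proof. by apply/colP => j; rewrite !mxE mxtens_indexK. Qed.

Lemma blockD x y i : block (x + y) i = block x i + block y i.
Proof. by apply/colP => j; rewrite !mxE. Qed.

Lemma blockB x y i : block (x - y) i = block x i - block y i.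
Proof. by apply/colP => j; rewrite !mxE. Qed.

Lemma blockZ (a : R) x i : block (a *: x) i = a *: block x i.
Proof. by apply/colP => j; rewrite !mxE. Qed.

Lemma block_meanD x y : block_mean (x + y) = block_mean x + block_mean y.
Proof.
by rewrite /block_mean -scalerDr -big_split/=; under eq_bigr do rewrite blockD.
Qed.

Lemma block_meanB x y : block_mean (x - y) = block_mean x - block_mean y.
Proof.
by rewrite /block_mean -scalerBr -sumrB; under eq_bigr do rewrite blockB.
Qed.

Lemma block_tens W x i : block ((W *t (1%:M : 'M[R]_p)) *m x) i =
  \sum_l W i l *: block x l.
Proof.
apply/colP => j; rewrite mxE mxE sum_mxtens summxE; apply: eq_bigr => l _.
rewrite (bigD1 j)//= big1 ?addr0 => [|k kj].
  by rewrite tensmxE !mxE eqxx mulr1.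
by rewrite tensmxE !mxE eq_sym (negbTE kj) mulr0 mul0r.
Qed.

Let slice_tens W x j :
  slice ((W *t (1%:M : 'M[R]_p)) *m x) j = W *m slice x j.
Proof.
apply/colP => i; rewrite mxE.
have /colP/(_ j) := block_tens W x i; rewrite mxE => ->.
by rewrite summxE mxE; apply: eq_bigr => l _; rewrite !mxE.
Qed.

Lemma enorm_tens_le W (b : R) x :
  0 <= b -> (forall v, enorm (W *m v) <= b * enorm v) ->
  enorm ((W *t (1%:M : 'M[R]_p)) *m x) <= b * enorm x.
Proof.
move=> b0 H; apply: enorm_le; first by rewrite mulr_ge0 ?enorm_ge0.
rewrite exprMn !sqr_enorm_slice mulr_sumr; apply: ler_sum => j _.
by rewrite slice_tens -exprMn ler_sqr ?nnegrE ?mulr_ge0 ?enorm_ge0.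
Qed.

Lemma block_avg x i : block ((avg_mx R n *t (1%:M : 'M[R]_p)) *m x) i =
  block_mean x.
Proof.
rewrite block_tens /block_mean scaler_sumr; apply: eq_bigr => l _.
by rewrite avg_mxE.
Qed.

Lemma block_mean_tens W x : doubly_stochastic W ->
  block_mean ((W *t (1%:M : 'M[R]_p)) *m x) = block_mean x.
Proof.
move=> [_ _ Wc]; rewrite /block_mean; congr (_ *: _).
under eq_bigr do rewrite block_tens.
rewrite exchange_big/=; apply: eq_bigr => l _.
by rewrite -scaler_suml Wc scale1r.
Qed.

Lemma tensmxBl (A B : 'M[R]_n) (C : 'M[R]_p) : (A - B) *t C = A *t C - B *t C.
Proof. by apply/matrixP => i j; rewrite !mxE mulrBl. Qed.

Lemma tens1mx_id x : ((1%:M : 'M[R]_n) *t (1%:M : 'M[R]_p)) *m x = x.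
Proof.
apply/colP => k; case: (mxtens_indexP k) => i j {k}.
have /colP/(_ j) := block_tens 1%:M x i; rewrite mxE => ->.
rewrite (bigD1 i)//= big1 ?addr0 => [|l li].
  by rewrite !mxE eqxx mul1r.
by rewrite mxE eq_sym (negbTE li) scale0r.
Qed.

Lemma enorm_sub_tens_avg_le x : (0 < n)%N ->
  enorm (x - (avg_mx R n *t (1%:M : 'M[R]_p)) *m x) <= enorm x.
Proof.
move=> n0; rewrite -[leRHS]mul1r -{1}[x]tens1mx_id -mulmxBl -tensmxBl.
apply: enorm_tens_le => // v; rewrite mul1r mulmxBl mul1mx.
exact: enorm_sub_avg_le.
Qed.

End Blocks.

(** * The quantized consensus steps of one iteration *)

Section QuantizedConsensus.
Variables (R : realType) (n p t : nat) (W : 'M[R]_n).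
Variables (x eps : nat -> 'cV[R]_(n * p)) (d : R).
Hypotheses (n_gt0 : (0 < n)%N) (dsW : doubly_stochastic W).
Let Z := W *t (1%:M : 'M[R]_p).
Let P := avg_mx R n *t (1%:M : 'M[R]_p).
Hypothesis x_step : forall j, (j < t)%N -> x j.+1 = Z *m (x j + eps j).

(** As [u] need not be fixed by [Z], the iterates are compared with the exact orbit [U j] of [u]:
    the errors add up by nonexpansiveness, and returning from [U t] to [u] costs at most
    [2 * enorm u]. *)
Lemma consensus_enorm_sub_le (u : 'cV[R]_(n * p)) :
  (forall j, (j < t)%N -> enorm (eps j) <= d) ->
  enorm (x t - u) <= enorm (x 0%N - u) + 2 * enorm u + t%:R * d.
Proof.
move=> eps_le; have Z_le v : enorm (Z *m v) <= enorm v.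
  rewrite -[leRHS]mul1r; apply: enorm_tens_le => // w.
  by rewrite mul1r; exact: doubly_stochastic_enorm_le.
pose U j := iter j (mulmx Z) u.
have U_le j : enorm (U j) <= enorm u.
  by elim: j => [//|j IH]; apply: le_trans (Z_le _) IH.
have xU j : (j <= t)%N -> enorm (x j - U j) <= enorm (x 0%N - u) + j%:R * d.
  elim: j => [_|j IH jt]; first by rewrite mul0r addr0.
  rewrite x_step// /U iterS -/(U j) -mulmxBr; apply: le_trans (Z_le _) _.
  rewrite addrAC; apply: le_trans (enormD _ _) _.
  have := IH (ltnW jt); have := eps_le j jt; rewrite -[j.+1]addn1 natrD; lra.
have -> : x t - u = (x t - U t) + (U t - u) by rewrite addrA subrK.
apply: le_trans (enormD _ _) _; have := xU t (leqnn t).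
have := enormD (U t) (- u); rewrite enormN; have := U_le t; lra.
Qed.

Lemma consensus_deviation_le :
  (forall j, (j < t)%N -> enorm (eps j) <= d) ->
  enorm (x t - P *m x t) <= consensus_rate W ^+ t * enorm (x 0%N) + t%:R * d.
Proof.
move=> eps_le; set b := consensus_rate W.
have b0 : 0 <= b by exact: consensus_rate_ge0.
have b1 : b <= 1 by exact: consensus_rate_le1.
(* Both [W] followed by removal of the mean, and removal of the mean followed by [W - avg_mx R n],
   equal [W - avg_mx R n]. Hence a step maps deviations to deviations with factor [b]. *)
have ZP v : Z *m v - P *m (Z *m v) =
    ((W - avg_mx R n) *t (1%:M : 'M[R]_p)) *m (v - P *m v).
  rewrite tensmxBl -/Z -/P mulmxBl !mulmxBr !mulmxA /Z /P !tensmx_mul.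
  rewrite mulmx1 (mulmx_avg dsW) (avg_mulmx dsW).
  by rewrite (mulmx_avg (avg_doubly_stochastic R n_gt0)) subrr subr0.
have main j : (j <= t)%N ->
    enorm (x j - P *m x j) <= b ^+ j * enorm (x 0%N) + j%:R * d.
  elim: j => [_|j IH jt].
    by rewrite mul1r mul0r addr0; exact: enorm_sub_tens_avg_le.
  rewrite x_step// ZP.
  apply: le_trans (enorm_tens_le _ b0 (consensus_rate_enorm_le W)) _.
  have -> : x j + eps j - P *m (x j + eps j) =
      (x j - P *m x j) + (eps j - P *m eps j).
    by rewrite mulmxDr opprD addrACA.
  have h1 := enormD (x j - P *m x j) (eps j - P *m eps j).
  have h2 : enorm (eps j - P *m eps j) <= d.
    by apply: le_trans (enorm_sub_tens_avg_le _ n_gt0) (eps_le j jt).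
  have h3 := IH (ltnW jt).
  apply: le_trans (_ : b * (b ^+ j * enorm (x 0%N) + (j%:R * d + d)) <= _).
    by rewrite ler_wpM2l//; lra.
  rewrite mulrDr mulrA -exprS lerD2l -[j.+1]addn1 natrD mulrDl mul1r.
  (* [b <= 1] is applied to the accumulated errors only, which leaves [j.+1] times [d]. *)
  rewrite ler_piMl// addr_ge0 ?mulr_ge0 ?ler0n//;
  exact: le_trans (enorm_ge0 _) (eps_le j jt).
exact: main.
Qed.

(** [Z] preserves block means, so the mean moves only by the means of the errors, which have their
    own bound. *)
Lemma consensus_mean_le :
  (forall j, (j < t)%N -> enorm (block_mean (eps j)) <= d) ->
  enorm (block_mean (x t) - block_mean (x 0%N)) <= t%:R * d.
Proof.
move=> eps_le.
suff main j : (j <= t)%N ->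
    enorm (block_mean (x j) - block_mean (x 0%N)) <= j%:R * d by exact: main.
elim: j => [_|j IH jt]; first by rewrite subrr enorm0 mul0r.
rewrite x_step// block_mean_tens// block_meanD addrAC.
apply: le_trans (enormD _ _) _; have := IH (ltnW jt); have := eps_le j jt.
by rewrite -[j.+1]addn1 natrD; lra.
Qed.

End QuantizedConsensus.

(** * Extrema of finite families *)

Section FiniteExtrema.
Variables (R : realType) (n : nat).
Implicit Type a : 'I_n -> R.

Lemma le_max_idx a i : a i <= max_idx a.
Proof.
apply: ub_le_sup; last by exists i.
exists (\sum_j `|a j|) => _ [j _ <-]; apply: le_trans (ler_norm _) _.
by rewrite (bigD1 j)//= lerDl sumr_ge0.
Qed.

Lemma min_idx_le a i : min_idx a <= a i.
Proof.
apply: ge_inf; last by exists i.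
exists (- \sum_j `|a j|) => _ [j _ <-]; rewrite lerNl.
apply: le_trans (_ : `|a j| <= _); first by rewrite -normrN ler_norm.
by rewrite (bigD1 j)//= lerDl sumr_ge0.
Qed.

Lemma min_idx_gt0 a : (0 < n)%N -> (forall i, 0 < a i) -> 0 < min_idx a.
Proof.
move=> n0 a0; pose i0 := Ordinal n0.
have [i _ imin] := arg_minP a (isT : xpredT i0).
apply: lt_le_trans (a0 i) _; apply: lb_le_inf; first by exists (a i0), i0.
by move=> _ [j _ <-]; exact: imin.
Qed.

End FiniteExtrema.

(** [E / (1 - c)] is the fixed point of the affine map with slope [c] and intercept [E], so the
    bound reproduces itself. *)
Lemma linear_recursion_le (R : realType) (u : nat -> R) (c E : R) :
  0 <= c < 1 -> 0 <= E -> (forall k, u k.+1 <= c * u k + E) ->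
  forall k, u k <= c ^+ k * u 0%N + E / (1 - c).
Proof.
move=> /andP[c0 c1] E0 step; elim=> [|k IH].
  by rewrite mul1r lerDl divr_ge0// subr_ge0 ltW.
apply: le_trans (step k) _.
apply: le_trans (_ : c * (c ^+ k * u 0%N + E / (1 - c)) + E <= _).
  by rewrite lerD2r ler_wpM2l.
by rewrite le_eqVlt; apply/orP; left; apply/eqP; rewrite exprS; field; lra.
Qed.

(** * Gradient steps, stacked and averaged *)

Section GradientStep.
Variables (R : realType) (n p : nat).
Variables (f : 'I_n -> 'cV[R]_p -> R) (mu Lip : 'I_n -> R).
Hypothesis sandwich :
  forall i, quad_sandwich (mu i) (Lip i) (f i) (gradient (f i)).

(** The factor [1 - nu / 2] replaces a square root so that iteration gives a geometric series of sum
    [2 / nu]. *)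
Lemma stacked_gradient_step_le (alpha nu : R) (u : 'I_n -> 'cV[R]_p)
    (v : 'cV[R]_(n * p)) :
  (forall i, 0 < mu i) -> (forall i, mu i <= Lip i) -> 0 <= alpha ->
  (forall i, alpha <= 2 / (mu i + Lip i)) ->
  (forall i, gradient (f i) (u i) = 0) -> 0 <= nu <= 2 ->
  (forall i, nu <= alpha * (2 * mu i * Lip i / (mu i + Lip i))) ->
  enorm (v - alpha *: stacked_gradient f v - stack u) <=
  (1 - nu / 2) * enorm (v - stack u).
Proof.
move=> mu0 muL a0 aL gu /andP[nu0 nu2] nuL.
apply: enorm_le; first by rewrite mulr_ge0 ?enorm_ge0//; lra.
(* [sqrt (1 - nu) <= 1 - nu / 2] *)
rewrite exprMn; apply: le_trans (_ : (1 - nu) * enorm (v - stack u) ^+ 2 <= _).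
  rewrite !sqr_enorm_block mulr_sumr; apply: ler_sum => i _.
  rewrite !blockB blockZ !block_stack.
  apply: le_trans (gradient_step_contraction (block v i) (mu0 i) (muL i) a0 (aL i)
    (@sandwich i) (gu i)) _.
  by rewrite ler_wpM2r ?sqr_ge0// lerD2l lerN2.
by rewrite ler_wpM2r ?sqr_ge0//; have := sqr_ge0 nu; lra.
Qed.

(** Both bounds are linear in the function, its gradient and the constants jointly, so they average;
    this is how the mean constants enter the rate. *)
Lemma quad_sandwich_mean :
  quad_sandwich (n%:R^-1 * \sum_i mu i) (n%:R^-1 * \sum_i Lip i)
    (fun z => n%:R^-1 * \sum_i f i z)
    (fun z => n%:R^-1 *: \sum_i gradient (f i) z).
Proof.
move=> x y; have n0 : 0 <= n%:R^-1 :> R by rewrite invr_ge0 ler0n.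
have E (c : 'I_n -> R) : n%:R^-1 * \sum_i f i x +
    dotv (n%:R^-1 *: \sum_i gradient (f i) x) (y - x) +
    n%:R^-1 * \sum_i c i / 2 * enorm (y - x) ^+ 2 =
    n%:R^-1 * \sum_i (f i x + dotv (gradient (f i) x) (y - x) +
      c i / 2 * enorm (y - x) ^+ 2).
  by rewrite dotvZl dotv_suml -!mulrDr -!big_split.
have F (c : 'I_n -> R) : (n%:R^-1 * \sum_i c i) / 2 * enorm (y - x) ^+ 2 =
    n%:R^-1 * \sum_i c i / 2 * enorm (y - x) ^+ 2.
  by rewrite -mulrA -mulrA mulr_suml; congr (_ * _); apply: eq_bigr => i _; rewrite mulrA.
rewrite !F !E; apply/andP; split; apply: ler_wpM2l => //; apply: ler_sum => i _;
  by have /andP[] := sandwich i x y.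
Qed.

Lemma mean_gradient_step_le (alpha L : R) (v : 'cV[R]_(n * p)) (xs : 'cV[R]_p) :
  let mu_bar := n%:R^-1 * \sum_(i < n) mu i in
  let L_bar := n%:R^-1 * \sum_(i < n) Lip i in
  (0 < n)%N -> 0 < mu_bar -> mu_bar <= L_bar -> 0 <= alpha ->
  alpha <= 2 / (mu_bar + L_bar) -> 0 <= L ->
  (forall i x y, enorm (gradient (f i) x - gradient (f i) y) <=
     L * enorm (x - y)) ->
  is_argmin (fun z => \sum_(i < n) f i z) xs ->
  enorm (block_mean (v - alpha *: stacked_gradient f v) - xs) <=
  Num.sqrt (1 - alpha * (2 * mu_bar * L_bar / (mu_bar + L_bar))) *
    enorm (block_mean v - xs)
  + alpha * L * enorm (v - (avg_mx R n *t (1%:M : 'M[R]_p)) *m v).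
Proof.
move=> mu_bar L_bar n0 mu0 muL a0 aL L0 lip xsmin.
pose G z := n%:R^-1 *: \sum_i gradient (f i) z.
have n_pos : 0 < n%:R^-1 :> R by rewrite invr_gt0 ltr0n.
have Gxs : G xs = 0.
  apply: (quad_sandwich_argmin _ quad_sandwich_mean); first exact: lt_le_trans mu0 muL.
  by move=> z; rewrite ler_pM2l.
set xb := block_mean v.
(* The cost of evaluating each gradient at its own block rather than at the mean; what remains is an
   exact gradient step on the average function. *)
pose err := \sum_i (gradient (f i) (block v i) - gradient (f i) xb).
have -> : block_mean (v - alpha *: stacked_gradient f v) - xs =
    (xb - alpha *: G xb - xs) - (alpha * n%:R^-1) *: err.
  rewrite block_meanB -/xb.
  have -> : block_mean (alpha *: stacked_gradient f v) =
      alpha *: G xb + (alpha * n%:R^-1) *: err.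
    rewrite /block_mean /G /err sumrB -scalerA -scalerDr -scalerDr.
    rewrite [X in _ = alpha *: (_ *: X)]addrC subrK.
    under eq_bigr do rewrite blockZ block_stack.
    by rewrite -scaler_sumr !scalerA mulrC.
  by rewrite opprD (addrA xb) [LHS]addrAC.
apply: le_trans (enormD _ _) _; apply: lerD.
  apply: enorm_le; first by rewrite mulr_ge0 ?sqrtr_ge0 ?enorm_ge0.
  apply: le_trans (gradient_step_contraction xb mu0 muL a0 aL quad_sandwich_mean Gxs) _.
  rewrite exprMn; apply: ler_wpM2r; first exact: sqr_ge0.
  (* For a negative radicand [Num.sqrt] is 0, and [r <= Num.sqrt r ^+ 2] still holds. *)
  set r := 1 - _; have [r0|/ltW r0] := leP 0 r; first by rewrite sqr_sqrtr.
  by apply: le_trans r0 _; exact: sqr_ge0.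
rewrite enormN enormZ ger0_norm ?mulr_ge0 ?(ltW n_pos)//.
rewrite -!mulrA ler_wpM2l// ler_pdivrMl ?ltr0n//.
apply: le_trans (enorm_sum _) _.
set dv := enorm _.
(* Every block is bounded by the whole deviation [dv]; the [n] equal terms match the factor [n%:R]
   moved from the left. *)
apply: le_trans (_ : \sum_(i < n) L * dv <= _); last first.
  by rewrite sumr_const card_ord mulr_natl.
apply: ler_sum => i _; apply: le_trans (lip i _ _) _; rewrite ler_wpM2l//.
by rewrite /xb -(block_avg v i) -blockB; exact: enorm_block_le.
Qed.

End GradientStep.

(** * The error recursion of the method *)

Theorem mainTheorem2 (R : realType) (n p t : nat)
  (f : 'I_n -> 'cV[R]_p -> R) (mu Lip : 'I_n -> R)
  (e : rel 'I_n) (W : 'M[R]_n) (alpha Delta : R)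
  (y : nat -> 'cV[R]_(n * p)) (x eps : nat -> nat -> 'cV[R]_(n * p))
  (xstar : 'cV[R]_p) (ustar : 'I_n -> 'cV[R]_p) :
  let L := max_idx Lip in
  let mu_bar := n%:R^-1 * \sum_(i < n) mu i in
  let L_bar := n%:R^-1 * \sum_(i < n) Lip i in
  let c6 := 2 / (mu_bar + L_bar) in
  let beta := consensus_rate W in
  let tDelta := Num.sqrt (n * p)%:R * Delta in
  let nu := 2 * alpha * min_idx (fun i => mu i * Lip i / (mu i + Lip i)) in
  let D := enorm (y 0%N - stack ustar) + (nu + 4) / nu * enorm (stack ustar) in
  let c2 := 2 * mu_bar * L_bar / (mu_bar + L_bar) in
  let c1 := Num.sqrt (1 - alpha * c2) in
  let c3 := alpha * D * L in
  let c4 := 2 * alpha * L / nu in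
  let c5 := 1 / Num.sqrt n%:R * (alpha * L * (Num.sqrt n%:R + 1) + 1) in
  let xbar := fun k : nat => block_mean (x k t) in
  (1 < n)%N -> (1 <= p)%N -> (1 <= t)%N ->
  (forall i : 'I_n, 0 < mu i) ->
  (forall i : 'I_n, strongly_convex (mu i) (f i)) ->
  (forall i : 'I_n, lipschitz_gradient (Lip i) (f i)) ->
  connected_graph e -> consensus_matrix e W ->
  0 < alpha -> alpha <= Num.min (1 / L) c6 ->
  near_dgd_q f W alpha t y x eps ->
  quantization_error_bound t Delta eps ->
  is_argmin (fun z : 'cV[R]_p => \sum_(i < n) f i z) xstar ->
  (forall i : 'I_n, is_argmin (f i) (ustar i)) ->
  forall k : nat,
    enorm (xbar k - xstar) <=
      c1 ^+ k * enorm (xbar 0%N - xstar)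
      + c3 * beta ^+ t / (1 - c1)
      + c4 * beta ^+ t * t%:R * tDelta / (1 - c1)
      + c5 * t%:R * tDelta / (1 - c1).
Proof.
move=> L mu_bar L_bar c6 beta tDelta nu D c2 c1 c3 c4 c5 xbar.
move=> n1 p0 t0 mu0 scf lipf _ cmW alpha0 alphaL dgd quant xsmin usmin.
have n0 : (0 < n)%N by exact: ltnW.
have dsW := cm_ds cmW.
have sandwich i := quad_sandwich_gradient (scf i) (lipf i).
have muL i : mu i <= Lip i by exact: quad_sandwich_le p0 (sandwich i).
have Lip0 i : 0 < Lip i by exact: lt_le_trans (mu0 i) (muL i).
have LipL i : Lip i <= L by exact: le_max_idx.
pose i0 := Ordinal n0.
have L0 : 0 < L by exact: lt_le_trans (Lip0 i0) (LipL i0).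
move: alphaL; rewrite le_min => /andP[aL ac6].
have aLip i : alpha * Lip i <= 1.
  apply: le_trans (_ : alpha * L <= 1); first by rewrite ler_pM2l.
  by rewrite -ler_pdivlMr.
have a2 i : alpha <= 2 / (mu i + Lip i).
  by rewrite ler_pdivlMr ?addr_gt0//; have := aLip i; have := muL i; nra.
have gu i : gradient (f i) (ustar i) = 0.
  exact: quad_sandwich_argmin (Lip0 i) (sandwich i) (usmin i).
have nu0 : 0 < nu.
  rewrite /nu mulr_gt0 ?mulr_gt0//; apply: min_idx_gt0 => // i.
  by rewrite divr_gt0 ?mulr_gt0 ?addr_gt0.
have nu_le i : nu <= alpha * (2 * mu i * Lip i / (mu i + Lip i)).
  have := min_idx_le (fun i => mu i * Lip i / (mu i + Lip i)) i.
  by rewrite -(ler_pM2l (mulr_gt0 (ltr0n _ 2) alpha0)) -/nu; lra.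
have nu2 : nu <= 2.
  apply: le_trans (nu_le i0) _.
  rewrite mulrA ler_pdivrMr ?addr_gt0//.
  by have := aLip i0; have := mu0 i0; have := Lip0 i0; nra.
(* The sign of [Delta] is read off the error bound at [k = j = 0], available because [1 <= t]. *)
have tD0 : 0 <= tDelta.
  by apply: le_trans (enorm_ge0 (eps 0%N 0%N)) _; case: (quant 0%N 0%N t0).
pose pD := Num.sqrt p%:R * Delta.
have pD0 : 0 <= pD.
  by apply: le_trans (enorm_ge0 (block_mean (eps 0%N 0%N))) _; case: (quant 0%N 0%N t0).
have sqn0 : 0 < Num.sqrt n%:R :> R by rewrite sqrtr_gt0 ltr0n.
have tpD : tDelta = Num.sqrt n%:R * pD.
  by rewrite /tDelta /pD natrM sqrtrM ?ler0n// mulrA.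
have eps_le k j : (j < t)%N -> enorm (eps k j) <= tDelta by case/(quant k).
have mean_le k j : (j < t)%N -> enorm (block_mean (eps k j)) <= pD.
  by case/(quant k).
have [x0 xS yS] := dgd.
(* With [B] the drift of one round of consensus, the distances satisfy
   [a k.+1 <= (1 - nu / 2) * (a k + B)], which preserves the bound [a 0 + 2 / nu * B]. *)
have y_dist k : enorm (y k - stack ustar) <= enorm (y 0%N - stack ustar) +
    2 / nu * (2 * enorm (stack ustar) + t%:R * tDelta).
  set B := 2 * _ + _; have B0 : 0 <= B.
    by rewrite addr_ge0// mulr_ge0// enorm_ge0.
  elim: k => [|k IH]; first by rewrite lerDl mulr_ge0 ?divr_ge0 ?(ltW nu0).
  rewrite yS; apply: le_trans (stacked_gradient_step_le sandwich (x k t) mu0 muL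
    (ltW alpha0) a2 gu _ nu_le) _; first by rewrite (ltW nu0).
  have := consensus_enorm_sub_le dsW (xS k) (stack ustar) (eps_le k).
  rewrite x0 -addrA -/B => h.
  have := enorm_ge0 (y 0%N - stack ustar); set A := enorm (y 0%N - _) => A0.
  apply: le_trans (_ : (1 - nu / 2) * (A + 2 / nu * B + B) <= _).
    by rewrite ler_wpM2l//; [lra|apply: le_trans h _; rewrite lerD2r].
  have -> : (1 - nu / 2) * (A + 2 / nu * B + B) =
      A + 2 / nu * B - (nu / 2 * A + nu / 2 * B) by field; rewrite gt_eqF.
  by rewrite lerBlDr lerDl addr_ge0// mulr_ge0// divr_ge0// ltW.
have y_le k : enorm (y k) <= D + 2 / nu * (t%:R * tDelta).
  rewrite -[y k](subrK (stack ustar)); apply: le_trans (enormD _ _) _.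
  (* In the coefficient [(nu + 4) / nu], the part [4 / nu] is the drift from [y_dist], and the
     remaining 1 comes from adding [stack ustar] back. *)
  have -> : D = enorm (y 0%N - stack ustar) + 2 / nu * (2 * enorm (stack ustar))
    + enorm (stack ustar) by rewrite /D; field; rewrite gt_eqF.
  rewrite -[leRHS]addrA [X in _ <= _ + X]addrC addrA lerD2r.
  by apply: le_trans (y_dist k) _; rewrite mulrDr addrA.
have b0 : 0 <= beta ^+ t by rewrite exprn_ge0 ?consensus_rate_ge0.
have dev_le k : enorm (x k t - (avg_mx R n *t (1%:M : 'M[R]_p)) *m x k t) <=
    beta ^+ t * (D + 2 / nu * (t%:R * tDelta)) + t%:R * tDelta.
  apply: le_trans (consensus_deviation_le n0 dsW (xS k) (eps_le k)) _.
  by rewrite x0 lerD2r ler_wpM2l.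
have n_pos : 0 < n%:R^-1 :> R by rewrite invr_gt0 ltr0n.
have mub0 : 0 < mu_bar.
  rewrite mulr_gt0// (bigD1 i0)//= ltr_pwDl// sumr_ge0// => i _; exact: ltW.
have muLb : mu_bar <= L_bar by rewrite ler_pM2l// ler_sum.
have Lb0 : 0 < L_bar by exact: lt_le_trans mub0 muLb.
have c2_gt0 : 0 < c2.
  apply: divr_gt0; last exact: addr_gt0.
  by apply: mulr_gt0 => //; apply: mulr_gt0.
have c1_ge0 : 0 <= c1 by exact: sqrtr_ge0.
have c1_lt1 : c1 < 1.
  by rewrite /c1 -[ltRHS]sqrtr1 ltr_sqrt// gtrBl mulr_gt0.
pose E := c3 * beta ^+ t + c4 * beta ^+ t * t%:R * tDelta + c5 * t%:R * tDelta.
have E_ge0 : 0 <= E.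
  have [alpha_ge0 L_ge0 nu_ge0] : [/\ 0 <= alpha, 0 <= L & 0 <= nu] by rewrite !ltW.
  have sqn_ge0 := ltW sqn0; have t_ge0 : 0 <= t%:R :> R by exact: ler0n.
  have D_ge0 : 0 <= D.
    apply: addr_ge0; first exact: enorm_ge0.
    apply: mulr_ge0; last exact: enorm_ge0.
    by apply: divr_ge0 => //; exact: addr_ge0.
  have c3_ge0 : 0 <= c3 by do 2!apply: mulr_ge0 => //.
  have c4_ge0 : 0 <= c4 by apply: divr_ge0 => //; do 2!apply: mulr_ge0 => //.
  have c5_ge0 : 0 <= c5.
    apply: mulr_ge0; first exact: divr_ge0.
    apply: addr_ge0 => //; apply: mulr_ge0; first exact: mulr_ge0.
    exact: addr_ge0.
  apply: addr_ge0; last by do 2!apply: mulr_ge0 => //.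
  apply: addr_ge0; first exact: mulr_ge0.
  by do 3!apply: mulr_ge0 => //.
have step k : enorm (xbar k.+1 - xstar) <= c1 * enorm (xbar k - xstar) + E.
  (* The mean of [y k.+1] separates the quantization errors of round [k.+1] from the gradient step
     taken at [x k t]. *)
  rewrite -(subrK (block_mean (y k.+1)) (xbar k.+1)) -addrA.
  apply: le_trans (enormD _ _) _.
  have h1 := consensus_mean_le dsW (xS k.+1) (mean_le k.+1).
  have h2 := mean_gradient_step_le sandwich (x k t) n0 mub0 muLb (ltW alpha0) ac6
    (ltW L0) _ xsmin.
  have {}h2 := h2 (fun i z w => le_trans ((lipf i).2 z w)
    (ler_wpM2r (enorm_ge0 _) (LipL i))).
  rewrite -yS in h2.
  have h3 := ler_wpM2l (ltW (mulr_gt0 alpha0 L0)) (dev_le k).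
  rewrite x0 in h1.
  (* By [tpD], the [c5] term is the sum of [alpha * L * t%:R * tDelta] from the deviation,
     [t%:R * pD] from the mean errors, and [alpha * L * t%:R * pD], whose sign is [h4]. *)
  have -> : E = alpha * L * (beta ^+ t * (D + 2 / nu * (t%:R * tDelta)) +
      t%:R * tDelta) + t%:R * pD + alpha * L * (t%:R * pD).
    by rewrite /E /c3 /c4 /c5 tpD; field; rewrite !gt_eqF.
  have h4 : 0 <= alpha * L * (t%:R * pD) 
    by apply: mulr_ge0; [apply: mulr_ge0; exact: ltW|exact: mulr_ge0].
  rewrite -/c2 -/c1 in h2.
  by apply: le_trans (lerD h1 (le_trans h2 (lerD (lexx _) h3))) _; rewrite -/xbar; lra.
have c1_01 : 0 <= c1 < 1 by rewrite c1_ge0.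
move=> k; apply: le_trans (linear_recursion_le c1_01 E_ge0 step k) _.
by rewrite /E !mulrDl !addrA.
Qed.
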